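(* Let $\Delta$ be the clique complex of a chordal graph on vertex set $X$, with at least two maximal cliques $S_1,\ldots,S_e$ in a fixed leaf order and separators $Q_1,\ldots,Q_{e-1}$. For every subset $A\subseteq X$, the nonzero multigraded Betti numbers in positive homological degrees of the quotient $\mathbb K[\Delta^\vee]$ are given by $$\beta_{1,A}(\mathbb K[\Delta^\vee])=\bigl|\{m:X\setminus S_m=A\}\bigr|,\qquad\beta_{2,A}(\mathbb K[\Delta^\vee])=\bigl|\{q:X\setminus Q_q=A\}\bigr|.$$ All multigraded Betti numbers in homological degree at least three vanish. In particular, the multigraded Betti numbers in homological degree one determine the labeled complex $\Delta$, and those in homological degree two determine the separators with multiplicity.
   Context: $\mathbb K$ is a field and $R=\mathbb K[x:x\in X]$ with its $\mathbb Z^{X}$-multigrading. A simplicial complex $\Sigma$ on the finite set $X$ is a collection of subsets (faces) of $X$ closed under inclusion; elements of $X$ not lying in any face (ghost vertices) are allowed. The Alexander dual on $X$ is $\Sigma^\vee=\{F\subseteq X:X\setminus F\notin\Sigma\}$. $I_\Sigma\subseteq R$ is generated by the monomials $x_A=\prod_{x\in A}x$ with $A\subseteq X$, $A\notin\Sigma$; $\mathbb K[\Sigma]=R/I_\Sigma$. For $A\subseteq X$, $\beta_{i,A}(M)$ is the multigraded Betti number over $R$ in homological degree $i$ and squarefree multidegree $x_A$ (multigraded Betti numbers of Stanley–Reisner rings vanish in non-squarefree multidegrees). The clique complex of a finite graph consists of its cliques; its facets are the maximal cliques. A leaf order of the facets is an ordering $S_1,\ldots,S_e$ such that for each $m\ge2$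 there is $p(m)<m$ satisfying $S_m\cap S_i\subseteq S_m\cap S_{p(m)}$ for all $i<m$; such an order exists when the graph is chordal. For $1\le m\le e-1$ the separators are $Q_m=(S_1\cup\cdots\cup S_m)\cap S_{m+1}=S_{p(m+1)}\cap S_{m+1}$ (possibly empty). *)

(* Defs.v *)
From HB Require Import structures.
From mathcomp Require Import all_boot all_order all_algebra.
From mathcomp Require Import mpoly.
From Stdlib Require Import ClassicalEpsilon.

Set Implicit Arguments.
Unset Strict Implicit.
Unset Printing Implicit Defensive.

Import GRing.Theory.
Local Open Scope ring_scope.

(* A graph on the vertex set T is a symmetric irreflexive
   e : rel T; a simplicial complex on T is a Sigma : {set {set T}} closed under
   inclusion (ghost vertices, and the complex without faces, are allowed). *)

Section Complexes.
Variable T : finType.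
Implicit Types (e : rel T) (Sigma : {set {set T}}) (S : seq {set T}).

Definition simple_graph e : Prop := ssrbool.symmetric e /\ irreflexive e.

(* Every cycle on at least four distinct vertices has a chord, that is, an edge
   between two of its vertices that are not consecutive on the cycle. *)
Definition chordal e : Prop :=
  forall c : seq T, ucycle e c -> (4 <= size c)%N ->
  exists x y, [/\ x \in c, y \in c, e x y, y != next c x & x != next c y].

Definition clique_complex e : {set {set T}} :=
  [set A : {set T} | [forall x in A, forall y in A, (x != y) ==> e x y]].

Definition facets Sigma : {set {set T}} :=
  [set A | maxset (fun B : {set T} => B \in Sigma) A].

Definition alexander_dual Sigma : {set {set T}} :=
  [set F : {set T} | ~: F \notin Sigma].

(* Indices are shifted by one: S`_0, S`_1, ... stand for S_1, S_2, ... *)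
Definition leaf_order Sigma S : Prop :=
  [/\ uniq S, S =i facets Sigma &
    forall m, (0 < m < size S)%N -> exists2 p, (p < m)%N &
      forall i, (i < m)%N ->
        nth set0 S m :&: nth set0 S i \subset nth set0 S m :&: nth set0 S p].

(* separator S q is Q_(q+1), for q + 1 < size S. *)
Definition separator S (q : nat) : {set T} :=
  (\bigcup_(i < q.+1) nth set0 S i) :&: nth set0 S q.+1.

Definition separators S : seq {set T} := mkseq (separator S) (size S).-1.

End Complexes.

Section Betti.
Variables (K : fieldType) (T : finType).

(* The polynomial ring K[x : x in T]; the variable x is 'X_(enum_rank x). *)
Local Notation R := {mpoly K[#|T|]}.

Definition multidegree := {ffun T -> int}.

Definition sqfree (A : {set T}) : multidegree := [ffun x => (x \in A)%:Z].

Definition xprod (A : {set T}) : R := \prod_(x in A) 'X_(enum_rank x).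

Definition SR_ideal (Sigma : {set {set T}}) (p : R) : Prop :=
  exists c : {set T} -> R, p = \sum_(A : {set T} | A \notin Sigma) c A * xprod A.

(* p is zero or homogeneous of multidegree a. *)
Definition homogeneous (a : multidegree) (p : R) : Prop :=
  forall m : 'X_{1.. #|T|}, m \in msupp p ->
  forall x : T, (m (enum_rank x))%:Z = a x.

(* A sequence of multigraded free modules of finite rank
     F_i = \bigoplus_(j < frank i) R(- fdeg i j),
   the elements of F_i being row vectors over R and maps acting on the right:
   fdiff i : F_(i+1) -> F_i, while faug : F_0 -> R / I is given by
   representatives in R of the images of the basis vectors. *)
Record free_sequence := FreeSequence {
  frank : nat -> nat;
  fdeg : forall i : nat, 'I_(frank i) -> multidegree;
  fdiff : forall i, 'M[R]_(frank i.+1, frank i);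
  faug : 'cV[R]_(frank 0) }.

Arguments fdeg F {i} j : rename.

(* All maps preserve the multidegree. *)
Definition multigraded (F : free_sequence) : Prop :=
  (forall j, homogeneous (fdeg F j) (faug F j ord0)) /\
  (forall i (j : 'I_(frank F i.+1)) (k : 'I_(frank F i)),
     homogeneous (fdeg F j - fdeg F k) (fdiff F i j k)).

(* Exactness of ... -> F_2 -> F_1 -> F_0 -> R / I -> 0. *)
Definition resolves (I : R -> Prop) (F : free_sequence) : Prop :=
  [/\ forall p : R, exists u : 'rV[R]_(frank F 0), I (p - (u *m faug F) ord0 ord0),
      forall u : 'rV[R]_(frank F 0),
        I ((u *m faug F) ord0 ord0) <-> exists v, u = v *m fdiff F 0 &
      forall i (u : 'rV[R]_(frank F i.+1)),
        u *m fdiff F i = 0 <-> exists v, u = v *m fdiff F i.+1].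

(* The image of F_(i+1) lies in (x : x in T) F_i. *)
Definition minimal (F : free_sequence) : Prop :=
  forall i (j : 'I_(frank F i.+1)) (k : 'I_(frank F i)), (fdiff F i j k)@_0%MM = 0.

Definition minimal_free_resolution (I : R -> Prop) (F : free_sequence) : Prop :=
  [/\ multigraded F, resolves I F & minimal F].

Definition zero_sequence : free_sequence :=
  @FreeSequence (fun=> 0%N) (fun=> fun=> 0) (fun=> 0) 0.

(* A minimal multigraded free resolution of R / I_Sigma.  The value of epsilon
   is specified because such resolutions exist; zero_sequence only witnesses
   that the type is inhabited. *)
Definition SR_resolution (Sigma : {set {set T}}) : free_sequence :=
  epsilon (inhabits zero_sequence) (minimal_free_resolution (SR_ideal Sigma)).

(* The multigraded Betti number beta_(i,a)(R / I_Sigma): the number of copies of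
   R(-a) in F_i; it does not depend on the minimal resolution F. *)
Definition betti (Sigma : {set {set T}}) (i : nat) (a : multidegree) : nat :=
  #|[set j : 'I_(frank (SR_resolution Sigma) i) | fdeg (SR_resolution Sigma) j == a]|.

End Betti.

(* Main.v *)
Require Import Defs.
From HB Require Import structures.
From mathcomp Require Import all_boot all_order all_algebra.
From mathcomp Require Import mpoly.
From Stdlib Require Import ClassicalEpsilon.

Set Implicit Arguments.
Unset Strict Implicit.
Unset Printing Implicit Defensive.

(** The ideal of the dual complex is generated by the complements of the facets,
that is, by the monomials g_k = xprod (~: S_k).  A leaf order gives it linear
algebra of the simplest kind.  Let S_q be a facet, S_p its parent and
Q = S_p :&: S_q.  If u g_q lies in the ideal of the earlier generators, then
every variable x of S_q :\: Q divides u: no earlier facet contains x, so x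
divides all earlier generators, whereas x does not divide g_q.  Hence the colon
ideal of the earlier generators by g_q is principal, generated by
xprod (S_q :\: Q), and the syzygies of the g_k are freely generated by one
relation for each separator,
  xprod (S_q :\: Q) g_q = xprod (~: Q) = xprod (S_p :\: Q) g_p.
This yields a resolution 0 -> R^n -> R^(n+1) -> R ([leaf_resolution]) whose
basis vectors have the degrees of the complements of the facets and of the
separators.  The facets being incomparable, no entry of its matrices has a
constant term: the resolution is minimal.

The Betti numbers are read off an unspecified minimal resolution, so one also
needs that any two minimal resolutions F and G have the same degrees
([minimal_resolution_unique]).  Identity maps lift to graded maps phi : F -> G
and psi : G -> F, and the composites are homotopic to the identity.  By
minimality the homotopy vanishes modulo the variables, so that the matrices of
constant coefficients of phi and psi are inverse to each other.  Being graded,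
these matrices only link basis vectors of equal degrees; counting dimensions
degree by degree gives the equality ([card_block_leq]).

The last two claims follow: the complements of the facets and of the separators
are recovered, with multiplicity, from the squarefree degrees, and a complex is
determined by its facets. *)

Arguments fdeg {K T} F {i} j : rename.

(** * Homogeneous components *)

Section Homogeneous.
Import GRing.Theory.
Local Open Scope ring_scope.
Variables (K : fieldType) (T : finType).
Local Notation R := {mpoly K[#|T|]}.
Local Notation deg := (multidegree T).
Implicit Types (a b : deg) (p q : R).

Definition monomial_degree (m : 'X_{1.. #|T|}) : deg :=
  [ffun x => (m (enum_rank x))%:Z].

Lemma homogeneousP a p :
  homogeneous a p <-> {in msupp p, forall m, monomial_degree m = a}.
Proof.
split=> [hp m m_p | hp m m_p x]; first by apply/ffunP=> x; rewrite ffunE hp.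
by rewrite -(hp m m_p) ffunE.
Qed.

Lemma monomial_degreeD m1 m2 :
  monomial_degree (m1 + m2) = monomial_degree m1 + monomial_degree m2.
Proof. by apply/ffunP=> x; rewrite !ffunE mnmDE PoszD. Qed.

Lemma monomial_degree0 : monomial_degree 0 = 0.
Proof. by apply/ffunP=> x; rewrite !ffunE mnm0E. Qed.

Lemma homogeneousM a b p q :
  homogeneous a p -> homogeneous b q -> homogeneous (a + b) (p * q).
Proof.
move=> /homogeneousP hp /homogeneousP hq; apply/homogeneousP=> m /msuppM_le.
by case/allpairsP=> -[m1 m2] /= [/hp <- /hq <- ->]; apply: monomial_degreeD.
Qed.

Lemma homogeneous0 a : homogeneous a (0 : R).
Proof. by move=> m; rewrite msupp0. Qed.

Lemma homogeneousD a p q :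
  homogeneous a p -> homogeneous a q -> homogeneous a (p + q).
Proof.
by move=> hp hq m /msuppD_le; rewrite mem_cat => /orP[/hp | /hq].
Qed.

Lemma homogeneous_sum a (I : finType) (F : I -> R) :
  (forall i, homogeneous a (F i)) -> homogeneous a (\sum_i F i).
Proof.
by move=> hF; apply: big_ind => // [|p q]; [apply: homogeneous0 | apply: homogeneousD].
Qed.

Lemma homogeneous1 : homogeneous 0 (1 : R).
Proof.
by apply/homogeneousP=> m; rewrite msupp1 inE => /eqP ->; apply: monomial_degree0.
Qed.

Lemma homogeneous_coef0 a p : homogeneous a p -> a != 0 -> p@_0%MM = 0.
Proof.
move=> /homogeneousP hp a_neq0; apply/memN_msupp_eq0/negP=> /hp a0.
by rewrite -a0 monomial_degree0 eqxx in a_neq0.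
Qed.

(** The component of degree a.  Projecting to it turns an arbitrary lift along a
graded map into a graded lift. *)
Definition hpart a p : R :=
  \sum_(m <- msupp p | monomial_degree m == a) p@_m *: 'X_[m].

Lemma coef_hpart a p m :
  (hpart a p)@_m = if monomial_degree m == a then p@_m else 0.
Proof.
rewrite raddf_sum /= big_mkcond /=.
have [m_p | mNp] := boolP (m \in msupp p); last first.
  rewrite (memN_msupp_eq0 mNp) if_same big_seq big1 // => m' m'_p.
  case: ifP => // _; rewrite mcoeffZ mcoeffX.
  have [m'm | _] := eqVneq m' m; last by rewrite mulr0.
  by rewrite -m'm m'_p in mNp.
rewrite (bigD1_seq m) //= ?msupp_uniq // big1 ?addr0 => [|m' m'_neq].
  by case: ifP => // _; rewrite mcoeffZ mcoeffX eqxx mulr1.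
by case: ifP => // _; rewrite mcoeffZ mcoeffX (negPf m'_neq) mulr0.
Qed.

Lemma hpart_is_additive a : zmod_morphism (hpart a).
Proof.
move=> p q; apply/mpolyP=> m; rewrite mcoeffB !coef_hpart mcoeffB.
by case: ifP; rewrite ?subr0.
Qed.

HB.instance Definition _ a :=
  GRing.isZmodMorphism.Build R R (hpart a) (hpart_is_additive a).

Lemma hpart_homogeneous a p : homogeneous a (hpart a p).
Proof.
apply/homogeneousP=> m; rewrite mcoeff_msupp coef_hpart.
by have [// | _] := eqVneq (monomial_degree m) a; rewrite eqxx.
Qed.

Lemma hpart_id a p : homogeneous a p -> hpart a p = p.
Proof.
move/homogeneousP=> hp; apply/mpolyP=> m; rewrite coef_hpart.
by case: ifPn => // m_a; apply/esym/memN_msupp_eq0; apply: contra m_a => /hp ->.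
Qed.

(** The part of p of degree other than a - b only contributes monomials of degree
other than a to p * q. *)
Lemma hpartM a b p q :
  homogeneous b q -> hpart a (p * q) = hpart (a - b) p * q.
Proof.
move=> hq; rewrite -[in LHS](subrK (hpart (a - b) p) p) mulrDl raddfD /=.
rewrite [X in _ + X]hpart_id; last first.
  by rewrite -[a in homogeneous a](subrK b); apply/homogeneousM/hq/hpart_homogeneous.
rewrite [X in X + _](_ : _ = 0) ?add0r //; apply/mpolyP=> m.
rewrite coef_hpart mcoeff0; case: ifP => // /eqP m_a.
apply/memN_msupp_eq0/negP=> /msuppM_le /allpairsP[[m1 m2] /= [m1_p m2_q def_m]].
have def_b: monomial_degree m2 = b by apply: (homogeneousP _ _).1 m2_q.
move: m1_p; rewrite mcoeff_msupp mcoeffB coef_hpart.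
by rewrite -m_a def_m monomial_degreeD def_b addrK eqxx subrr eqxx.
Qed.

(** Degree-preserving maps between free modules whose basis vectors have the
degrees da and db. *)
Definition graded_mx m n (da : 'I_m -> deg) (db : 'I_n -> deg) (A : 'M[R]_(m, n)) :=
  forall i j, homogeneous (da i - db j) (A i j).

Lemma graded_mxM m n r (da : 'I_m -> deg) (db : 'I_n -> deg) (dc : 'I_r -> deg) A B :
  graded_mx da db A -> graded_mx db dc B -> graded_mx da dc (A *m B).
Proof.
move=> gA gB i k; rewrite mxE; apply: homogeneous_sum => j.
by rewrite -(subrK (db j) (da i)) -addrA; apply: homogeneousM.
Qed.

Lemma graded_lift m n r (da : 'I_m -> deg) (db : 'I_n -> deg) (dc : 'I_r -> deg)
    (A : 'M[R]_(m, r)) (D : 'M[R]_(n, r)) :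
  graded_mx da dc A -> graded_mx db dc D -> (exists V, A = V *m D) ->
  exists2 V, graded_mx da db V & A = V *m D.
Proof.
move=> gA gD [V defA]; exists (\matrix_(i, j) hpart (da i - db j) (V i j)).
  by move=> i j; rewrite mxE; apply: hpart_homogeneous.
apply/matrixP=> i k; rewrite -(hpart_id (gA i k)) defA !mxE raddf_sum /=.
apply: eq_bigr => j _; rewrite mxE (hpartM _ _ (gD j k)).
by rewrite opprB addrA subrK.
Qed.

Lemma row_lift m n r (A : 'M[R]_(m, r)) (D : 'M[R]_(n, r)) :
  (forall i, exists v, row i A = v *m D) -> exists V, A = V *m D.
Proof.
case/(@fin_all_exists _ (fun _ => _))=> v def_v; exists (\matrix_i v i).
by apply/row_matrixP=> i; rewrite row_mul rowK.
Qed.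

End Homogeneous.
(** * Uniqueness of Betti numbers *)

Section Uniqueness.
Import GRing.Theory.
Local Open Scope ring_scope.
Variables (K : fieldType) (T : finType).
Local Notation R := {mpoly K[#|T|]}.
Implicit Types (F G : free_sequence K T) (I : R -> Prop).

(** Closure under homogeneous components is what allows lifts through the
augmentation to be chosen graded. *)
Definition homogeneous_ideal I :=
  [/\ I 0, forall p q, I p -> I q -> I (p + q), forall p q, I q -> I (p * q)
    & forall a p, I p -> I (hpart a p)].

Lemma ideal_comb I m (u : 'rV[R]_m) (c : 'cV[R]_m) :
  homogeneous_ideal I -> (forall j, I (c j ord0)) -> I ((u *m c) ord0 ord0).
Proof.
case=> I0 ID IM _ Ic; rewrite mxE; apply: big_ind => // j _.
exact: IM.
Qed.

Lemma resolves_mx I F i m (A : 'M[R]_(m, frank F i.+1)) :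
  resolves I F ->
  A *m fdiff F i = 0 <-> exists V, A = V *m fdiff F i.+1.
Proof.
case=> _ _ ex; split=> [A0 | [V ->]].
  apply: row_lift => j; apply/ex.
  by rewrite -row_mul A0; apply/rowP=> k; rewrite !mxE.
rewrite -mulmxA (_ : fdiff F i.+1 *m fdiff F i = 0) ?mulmx0 //.
apply/row_matrixP=> j; rewrite row_mul; apply: etrans (_ : 0 = _).
  by apply/ex; exists (delta_mx 0 j); rewrite rowE.
by apply/rowP=> k; rewrite !mxE.
Qed.

Lemma resolves_aug I F m (A : 'M[R]_(m, frank F 0)) :
  resolves I F -> (forall j, I ((A *m faug F) j ord0)) <-> exists V, A = V *m fdiff F 0.
Proof.
case=> _ ex _; split=> [A0 | [V ->] j].
  by apply: row_lift => j; apply/ex; rewrite -row_mul mxE.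
suff: I ((row j (V *m fdiff F 0) *m faug F) ord0 ord0) by rewrite -row_mul mxE.
by apply/ex; exists (row j V); rewrite row_mul.
Qed.

Definition const_mx0 m n (A : 'M[R]_(m, n)) : 'M[K]_(m, n) := map_mx (mcoeff 0%MM) A.

Lemma const_mx0_diff F i : minimal F -> const_mx0 (fdiff F i) = 0.
Proof. by move=> minF; apply/matrixP=> j k; rewrite !mxE minF. Qed.

(** Half of the invariant carried from one homological degree to the next.  Asking
for a lift of phi to degree i + 1, and keeping of the homotopy between
phi psi and the identity only its component H out of F_i, makes the induction
step independent of all lower degrees: the other component of the homotopy
passes through the differential out of F_i, so it dies when composed with the
differential into F_i. *)
Definition comparison F G i
    (phi : 'M[R]_(frank F i, frank G i)) (psi : 'M[R]_(frank G i, frank F i)) :=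
  [/\ graded_mx (fdeg F) (fdeg G) phi,
      exists V, fdiff F i *m phi = V *m fdiff G i,
      exists H, fdiff F i *m (1%:M - phi *m psi - H *m fdiff F i) = 0
    & const_mx0 (phi *m psi) = 1%:M].

Lemma const_mx0_1sub m (A B : 'M[R]_m) :
  1%:M - A = B -> const_mx0 B = 0 -> const_mx0 A = 1%:M.
Proof.
move=> def_B B0; have -> : A = 1%:M - B by rewrite -def_B opprB addrC subrK.
by rewrite /const_mx0 map_mxB -/(const_mx0 B) B0 subr0 map_mx1.
Qed.

(** In degree 0 the homotopy has the single component H: the composite phi psi
commutes with the augmentations modulo I, hence differs from the identity by
a map into the image of the differential. *)
Lemma comparison0_half I F G phi psi :
  homogeneous_ideal I -> minimal_free_resolution I F -> resolves I G ->
  graded_mx (fdeg F) (fdeg G) phi ->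
  (forall j, I ((faug F - phi *m faug G) j ord0)) ->
  (forall j, I ((faug G - psi *m faug F) j ord0)) ->
  comparison phi psi.
Proof.
move=> hI [_ resF minF] resG gphi Iphi Ipsi.
have [I0 ID IM _] := hI.
have IB p q : I p -> I q -> I (p - q).
  by move=> Ip Iq; apply: ID => //; rewrite -mulN1r; apply: IM.
have lift1 : exists V, fdiff F 0 *m phi = V *m fdiff G 0.
  apply/resolves_aug=> [|j]; first exact: resG.
  have ->: fdiff F 0 *m phi *m faug G =
      fdiff F 0 *m faug F - fdiff F 0 *m (faug F - phi *m faug G).
    by rewrite mulmxBr opprB addrC subrK mulmxA.
  rewrite mxE [X in _ + X]mxE; apply: IB.
    by move: j; apply/(resolves_aug (fdiff F 0) resF); exists 1%:M; rewrite mul1mx.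
  by have := ideal_comb (row j (fdiff F 0)) hI Iphi; rewrite -row_mul !mxE.
have [H def_H] : exists H, 1%:M - phi *m psi = H *m fdiff F 0.
  apply/resolves_aug=> [|j]; first exact: resF.
  have ->: (1%:M - phi *m psi) *m faug F =
      (faug F - phi *m faug G) + phi *m (faug G - psi *m faug F).
    by rewrite mulmxBl mul1mx mulmxBr addrA subrK mulmxA.
  rewrite mxE; apply: ID => //.
  by have := ideal_comb (row j phi) hI Ipsi; rewrite -row_mul !mxE.
split=> //; first by exists H; rewrite def_H subrr mulmx0.
apply: const_mx0_1sub def_H _.
by rewrite /const_mx0 map_mxM -/(const_mx0 (fdiff F 0)) const_mx0_diff ?mulmx0.
Qed.

Lemma aug_lift I F G :
  homogeneous_ideal I -> multigraded F -> multigraded G -> resolves I G ->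
  exists2 phi, graded_mx (fdeg F) (fdeg G) phi &
    forall j, I ((faug F - phi *m faug G) j ord0).
Proof.
case=> _ _ _ Ih [gF _] [gG _] [surj _ _].
have [V IV] := fin_all_exists (fun j => surj (faug F j ord0)).
exists (\matrix_(i, j) hpart (fdeg F i - fdeg G j) (V i ord0 j)).
  by move=> i j; rewrite mxE; apply: hpart_homogeneous.
move=> j; have := Ih (fdeg F j) _ (IV j); rewrite raddfB /= (hpart_id (gF j)).
congr (I _); rewrite !mxE; congr (_ - _); rewrite raddf_sum; apply: eq_bigr => k _.
by rewrite mxE /= (hpartM _ _ (gG k)).
Qed.

(** The usual induction step for chain maps and homotopies.  The map
1 - phi1 psi1 - d H takes values in the cycles because of the equation
satisfied by H, hence factors through the next differential as H1; minimality
kills the constant terms of both d H and H1 d. *)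
Lemma comparisonS_half I F G i phi psi phi1 psi1 :
  minimal_free_resolution I F -> resolves I G ->
  graded_mx (fdeg F) (fdeg G) phi1 ->
  fdiff F i *m phi = phi1 *m fdiff G i ->
  fdiff G i *m psi = psi1 *m fdiff F i ->
  @comparison F G i phi psi -> comparison phi1 psi1.
Proof.
move=> [_ resF minF] resG gphi1 def1 def1' [_ _ [H defH] _].
have dd0 : fdiff F i.+1 *m fdiff F i = 0.
  by apply/(resolves_mx _ resF); exists 1%:M; rewrite mul1mx.
have lift1 : exists V, fdiff F i.+1 *m phi1 = V *m fdiff G i.+1.
  by apply/(resolves_mx _ resG); rewrite -mulmxA -def1 mulmxA dd0 mul0mx.
have [H1 defH1] : exists H1, 1%:M - phi1 *m psi1 - fdiff F i *m H = H1 *m fdiff F i.+1.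
  apply/(resolves_mx _ resF).
  rewrite 2!mulmxBl mul1mx -!mulmxA -def1' (mulmxA phi1) -def1.
  by rewrite -{1}[fdiff F i]mulmx1 -!mulmxA -!mulmxBr.
split=> //.
  exists H1; rewrite -defH1 opprB addrC subrK.
  by rewrite mulmxA dd0 mul0mx.
apply: (const_mx0_1sub (B := fdiff F i *m H + H1 *m fdiff F i.+1)).
  by rewrite -defH1 [RHS]addrC subrK.
rewrite /const_mx0 map_mxD !map_mxM -!/(const_mx0 (fdiff F _)).
by rewrite !const_mx0_diff // mul0mx mulmx0 addr0.
Qed.

Lemma comparison_exists I F G i :
  homogeneous_ideal I -> minimal_free_resolution I F -> minimal_free_resolution I G ->
  exists phi psi, @comparison F G i phi psi /\ @comparison G F i psi phi.
Proof.
move=> hI mF mG; have [gF rF _] := mF; have [gG rG _] := mG.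
elim: i => [|i [phi [psi [cF cG]]]].
  have [phi gphi Iphi] := aug_lift hI gF gG rG.
  have [psi gpsi Ipsi] := aug_lift hI gG gF rF.
  exists phi, psi; split; first exact: comparison0_half hI mF rG gphi Iphi Ipsi.
  exact: comparison0_half hI mG rF gpsi Ipsi Iphi.
have [gphi lift_phi _ _] := cF; have [gpsi lift_psi _ _] := cG.
have gd (H : free_sequence K T) : multigraded H -> graded_mx (fdeg H) (fdeg H) (fdiff H i).
  by case=> _ gH; apply: gH.
have [phi1 g1 d1] := graded_lift (graded_mxM (gd _ gF) gphi) (gd _ gG) lift_phi.
have [psi1 g1' d1'] := graded_lift (graded_mxM (gd _ gG) gpsi) (gd _ gF) lift_psi.
exists phi1, psi1; split; first exact: comparisonS_half mF rG g1 d1 d1' cF.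
exact: comparisonS_half mG rF g1' d1' d1 cG.
Qed.

(** A one-sided inverse that respects a grading bounds the size of every block:
the block of A in degree a has a right inverse, so its row number is at most
its column number. *)
Lemma card_block_leq (D : eqType) m n (da : 'I_m -> D) (db : 'I_n -> D)
    (A : 'M[K]_(m, n)) (B : 'M[K]_(n, m)) (a : D) :
  (forall i j, A i j != 0 -> da i = db j) -> A *m B = 1%:M ->
  (#|[set i | da i == a]| <= #|[set j | db j == a]|)%N.
Proof.
move=> gA AB; set X := [set i | _]; set Y := [set j | _].
pose A' := mxsub (@enum_val _ (mem X)) (@enum_val _ (mem Y)) A.
pose B' := mxsub (@enum_val _ (mem Y)) (@enum_val _ (mem X)) B.
have A'B' : A' *m B' = 1%:M.
  apply/matrixP=> i k; rewrite !mxE.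
  have := congr1 (fun M : 'M_m => M (enum_val i) (enum_val k)) AB.
  rewrite !mxE (inj_eq enum_val_inj) => <-.
  rewrite [RHS](bigID (mem Y)) /= [X in _ = _ + X]big1 ?addr0 => [|j Yj].
    rewrite (big_enum_val (fun j => A (enum_val i) j * B j (enum_val k))) /=.
    by apply: eq_bigr => j _; rewrite !mxE.
  have [-> | /gA def_a] := eqVneq (A (enum_val i) j) 0; first by rewrite mul0r.
  by move: Yj (enum_valP i); rewrite !inE def_a => /negPf ->.
rewrite -(mxrank1 K #|X|) -A'B'; apply: leq_trans (mxrankM_maxr _ _) _.
exact: rank_leq_row.
Qed.

Lemma comparison_count F G i phi psi a :
  @comparison F G i phi psi ->
  (#|[set j | fdeg F (i := i) j == a]| <= #|[set k | fdeg G (i := i) k == a]|)%N.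
Proof.
case=> gphi _ _ inv.
apply: (@card_block_leq _ _ _ _ _ (const_mx0 phi) (const_mx0 psi)) => [j k|].
  rewrite mxE; apply: contra_neq_eq => j_k.
  by rewrite (homogeneous_coef0 (gphi j k)) ?subr_eq0.
by rewrite -inv /const_mx0 map_mxM.
Qed.

(** Multigraded Betti numbers may be read off any minimal resolution. *)
Theorem minimal_resolution_unique I F G i a :
  homogeneous_ideal I -> minimal_free_resolution I F -> minimal_free_resolution I G ->
  #|[set j | fdeg F (i := i) j == a]| = #|[set k | fdeg G (i := i) k == a]|.
Proof.
move=> hI mF mG; have [phi [psi [cF cG]]] := comparison_exists i hI mF mG.
by apply/eqP; rewrite eqn_leq (comparison_count _ cF) (comparison_count _ cG).
Qed.

End Uniqueness.
(** * Squarefree monomial ideals *)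

Section Squarefree.
Import GRing.Theory.
Local Open Scope ring_scope.
Variables (K : fieldType) (T : finType).
Local Notation R := {mpoly K[#|T|]}.
Implicit Types (A B C : {set T}) (p q : R) (Sigma : {set {set T}}) (x : T).

Definition sqfree_mnm A : 'X_{1.. #|T|} := [multinom (enum_val i \in A : nat) | i < #|T|].

Lemma sqfree_mnmE A x : sqfree_mnm A (enum_rank x) = (x \in A).
Proof. by rewrite mnmE enum_rankK. Qed.

Lemma xprodE A : xprod K A = 'X_[sqfree_mnm A].
Proof.
rewrite /xprod mprodXE; congr ('X_[_]); apply/mnmP=> j.
rewrite -[j]enum_valK sqfree_mnmE mnm_sumE; set x := enum_val j.
have [x_A | xNA] := boolP (x \in A).
  rewrite (bigD1 x) //= mnm1E eqxx big1 // => y /andP[_ y_x].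
  by rewrite mnm1E (inj_eq enum_rank_inj) (negPf y_x).
rewrite big1 // => y y_A; rewrite mnm1E (inj_eq enum_rank_inj).
by case: eqP y_A => // ->; rewrite (negPf xNA).
Qed.

Lemma xprod_neq0 A : xprod K A != 0.
Proof. by rewrite xprodE -msupp_eq0 msuppX. Qed.

Lemma xprodU A B : [disjoint A & B] -> xprod K (A :|: B) = xprod K A * xprod K B.
Proof.
by move=> dAB; rewrite /xprod -bigU //; apply: eq_bigl => x; rewrite !inE.
Qed.

Lemma xprodD_setC A C : C \subset A ->
  xprod K (A :\: C) * xprod K (~: A) = xprod K (~: C).
Proof.
move=> /subsetP CA; rewrite -xprodU.
  congr (xprod K _); apply/setP=> x; rewrite !inE.
  by have := CA x; case: (x \in C) => [->|]; rewrite ?orbN.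
rewrite -setI_eq0; apply/eqP/setP=> x; rewrite !inE.
by case: (x \in A); rewrite ?andbF.
Qed.

Lemma xprod_homogeneous A : homogeneous (sqfree A) (xprod K A).
Proof.
move=> m; rewrite xprodE msuppX inE => /eqP -> x.
by rewrite sqfree_mnmE ffunE.
Qed.

Lemma xprod_coef0 A : A != set0 -> (xprod K A)@_0%MM = 0.
Proof.
case/set0Pn=> x x_A; rewrite xprodE mcoeffX; case: eqP => // m0.
by have := sqfree_mnmE A x; rewrite m0 mnm0E x_A.
Qed.

Lemma sqfree_inj : injective (@sqfree T).
Proof.
move=> A B AB; apply/setP=> x; move: (congr1 (fun f : multidegree T => f x) AB).
by rewrite !ffunE; do 2!case: (x \in _).
Qed.

(** Divisibility by a variable is phrased with exponents, since this form passes
to sums and can be tested after multiplication by a monomial. *)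
Definition var_divides x p := {in msupp p, forall m : 'X_{1.. #|T|}, (0 < m (enum_rank x))%N}.

Lemma var_divides_sum x (I : finType) (P : pred I) (F : I -> R) :
  (forall i, P i -> var_divides x (F i)) -> var_divides x (\sum_(i | P i) F i).
Proof.
move=> dF; apply: big_ind => // [m|p q dp dq m /msuppD_le].
  by rewrite msupp0.
by rewrite mem_cat => /orP[/dp | /dq].
Qed.

Lemma var_dividesMx x A p : x \in A -> var_divides x (p * xprod K A).
Proof.
move=> x_A m; rewrite xprodE (perm_mem (msuppMX _ _)) => /mapP[m' _ ->].
by rewrite mnmDE sqfree_mnmE x_A.
Qed.

Lemma var_dividesMxE x A p : x \notin A -> var_divides x (p * xprod K A) -> var_divides x p.
Proof.
move=> xNA dp m m_p; have := dp (sqfree_mnm A + m)%MM.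
rewrite mnmDE sqfree_mnmE (negPf xNA) add0n; apply.
by rewrite xprodE (perm_mem (msuppMX _ _)); apply/mapP; exists m.
Qed.

(** Distinct variables are pairwise coprime primes: on exponents, divisibility by
each variable of A is divisibility by their product. *)
Lemma xprod_dvd A p :
  {in A, forall x, var_divides x p} -> exists q, p = q * xprod K A.
Proof.
move=> dp; exists (\sum_(m <- msupp p) p@_m *: 'X_[m - sqfree_mnm A]).
rewrite {1}(mpolyE p) mulr_suml [in LHS]big_seq [in RHS]big_seq.
apply: eq_bigr => m m_p; rewrite -scalerAl xprodE -mpolyXD submK //.
apply/mnm_lepP=> i; rewrite -[i]enum_valK sqfree_mnmE.
by case: (boolP (_ \in A)) => // /dp/(_ m m_p).
Qed.

Lemma SR_ideal_gen Sigma A p : A \notin Sigma -> SR_ideal Sigma (p * xprod K A).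
Proof.
move=> AS; exists (fun B => if B == A then p else 0).
rewrite (bigD1 A) //= eqxx big1 ?addr0 // => B /andP[_ /negPf ->].
exact: mul0r.
Qed.

Lemma SR_homogeneous_ideal Sigma : homogeneous_ideal (@SR_ideal K T Sigma).
Proof.
split.
- by exists (fun=> 0); rewrite big1 // => A _; rewrite mul0r.
- move=> _ _ [c ->] [d ->]; exists (fun A => c A + d A).
  by rewrite -big_split; apply: eq_bigr => A _; rewrite mulrDl.
- move=> p _ [c ->]; exists (fun A => p * c A).
  by rewrite mulr_sumr; apply: eq_bigr => A _; rewrite mulrA.
- move=> a _ [c ->]; exists (fun A => hpart (a - sqfree A) (c A)).
  by rewrite raddf_sum; apply: eq_bigr => A _; rewrite /= (hpartM _ _ (@xprod_homogeneous A)).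
Qed.

Lemma betti_of_resolution Sigma F i a :
  minimal_free_resolution (@SR_ideal K T Sigma) F ->
  betti K Sigma i a = #|[set j | fdeg F (i := i) j == a]|.
Proof.
move=> resF; apply: (minimal_resolution_unique _ _ (SR_homogeneous_ideal Sigma)) => //.
by apply: epsilon_spec; exists F.
Qed.

End Squarefree.

(** * Resolution attached to a leaf order *)

Section LeafResolution.
Import GRing.Theory.
Local Open Scope ring_scope.
Variables (K : fieldType) (T : finType) (n : nat).
Variables (S : 'I_n.+1 -> {set T}) (parent : 'I_n -> 'I_n.+1).
Local Notation R := {mpoly K[#|T|]}.

Definition next_facet (q : 'I_n) : 'I_n.+1 := lift ord0 q.

Hypothesis parent_leq : forall q, (parent q <= q)%N.
Hypothesis leaf : forall (q : 'I_n) (i : 'I_n.+1), (i <= q)%N ->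
  S (next_facet q) :&: S i \subset S (parent q).
Hypothesis S_incomparable : forall i j, S i \subset S j -> i = j.
Hypothesis n_gt0 : (0 < n)%N.

Definition sep q : {set T} := S (parent q) :&: S (next_facet q).

Definition leaf_gens : 'cV[R]_n.+1 := \col_k xprod K (~: S k).

(** Row q is the syzygy between the generators of S (next_facet q) and of its
parent, both of which divide the monomial of the complement of the separator. *)
Definition leaf_syz : 'M[R]_(n, n.+1) :=
  \matrix_(q, k) (((k == next_facet q)%:R - (k == parent q)%:R) * xprod K (S k :\: sep q)).

Lemma parent_neq q : (parent q == next_facet q) = false.
Proof.
by apply/negbTE; rewrite -val_eqE /= /bump leq0n add1n neq_ltn ltnS parent_leq.
Qed.

Lemma leaf_syz_row q (c : 'I_n.+1 -> R) :
  \sum_k leaf_syz q k * c k =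
    xprod K (S (next_facet q) :\: sep q) * c (next_facet q)
      - xprod K (S (parent q) :\: sep q) * c (parent q).
Proof.
rewrite (bigD1 (next_facet q)) //= (bigD1 (parent q)) ?parent_neq //= !mxE !eqxx.
rewrite parent_neq eq_sym parent_neq subr0 sub0r mul1r mulN1r mulNr.
rewrite [X in _ + (_ + X)]big1 ?addr0 // => k /andP[/negPf k1 /negPf k2].
by rewrite mxE k1 k2 subrr !mul0r.
Qed.

Lemma leaf_syz_gens : leaf_syz *m leaf_gens = 0.
Proof.
apply/matrixP=> q j; rewrite mxE leaf_syz_row !mxE.
by rewrite !xprodD_setC ?subsetIl ?subsetIr ?subrr.
Qed.

(** A coefficient of S (next_facet q) in a relation between the generators up to
that one is divisible by the variables outside of the separator: by the leaf
property they do not lie in an earlier facet, so that they divide all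
earlier generators, but they do not divide the generator itself. *)
Lemma last_coef_dvd (u : 'rV[R]_n.+1) (q : 'I_n) :
  u *m leaf_gens = 0 -> (forall k : 'I_n.+1, (q.+1 < k)%N -> u ord0 k = 0) ->
  exists c, u ord0 (next_facet q) = c * xprod K (S (next_facet q) :\: sep q).
Proof.
move=> u0 u_gt; apply: xprod_dvd => x; rewrite !inE => /andP[xNsep x_S].
apply: (@var_dividesMxE _ _ _ (~: S (next_facet q))); first by rewrite inE x_S.
have := congr1 (fun M : 'M_1 => M ord0 ord0) u0.
rewrite !mxE (bigD1 (next_facet q)) //= mxE => /eqP; rewrite addr_eq0 -sumrN => /eqP ->.
apply: var_divides_sum => k k_q; rewrite mxE -mulNr.
case: (ltngtP k q.+1) => [k_lt | /u_gt -> | k_eq].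
- apply: var_dividesMx; rewrite inE; apply: contra xNsep => x_Sk.
  by rewrite x_S andbT; apply: (subsetP (leaf (q := q) (i := k) k_lt)); rewrite inE x_S.
- by rewrite oppr0 mul0r => m; rewrite msupp0.
- by move/eqP: k_q; case; apply: val_inj; rewrite /= /bump leq0n add1n.
Qed.

(** Subtracting the multiple of a row of leaf_syz given by last_coef_dvd removes
the last coefficient of a relation; induction on the largest index m with a
nonzero coefficient does the rest. *)
Lemma leaf_syz_exact (u : 'rV[R]_n.+1) :
  u *m leaf_gens = 0 -> exists v, u = v *m leaf_syz.
Proof.
suff ind m : forall w : 'rV[R]_n.+1, (m <= n)%N -> w *m leaf_gens = 0 ->
    (forall k : 'I_n.+1, (m < k)%N -> w ord0 k = 0) -> exists v, w = v *m leaf_syz.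
  by move=> u0; apply: (ind n) => // k; rewrite ltnNge -ltnS ltn_ord.
elim: m => [|m IHm] w m_n w0 w_gt.
  (* A relation on a single generator is trivial in a domain. *)
  exists 0; rewrite mul0mx; apply/rowP=> k; rewrite mxE.
  case: (unliftP ord0 k) => [j ->|->]; first by rewrite w_gt.
  move/(congr1 (fun M : 'M_1 => M ord0 ord0)): w0; rewrite !mxE big_ord_recl big1.
    by move/eqP; rewrite addr0 mulf_eq0 mxE (negPf (xprod_neq0 _ _)) orbF => /eqP.
  by move=> j _; rewrite w_gt ?mul0r.
pose q := Ordinal m_n.
have [c def_c] := last_coef_dvd (q := q) w0 w_gt.
have [|||v def_v] := IHm (w - (c *: row q leaf_syz)); first exact: ltnW.
- by rewrite mulmxBl w0 -scalemxAl -row_mul leaf_syz_gens row0 scaler0 subrr.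
- move=> k; rewrite leq_eqVlt => /orP[/eqP k_eq | k_gt].
    have -> : k = next_facet q by apply: val_inj; rewrite /= /bump leq0n add1n -k_eq.
    by rewrite !mxE def_c eqxx eq_sym parent_neq subr0 mul1r subrr.
  have /negPf k_next : k != next_facet q.
    by rewrite -val_eqE /= /bump leq0n add1n neq_ltn k_gt orbT.
  have /negPf k_parent : k != parent q.
    rewrite -val_eqE neq_ltn (leq_trans _ k_gt) ?orbT // ltnS leqW //.
    exact: parent_leq.
  by rewrite !mxE w_gt // k_next k_parent subrr mul0r mulr0 subrr.
by exists (v + c *: delta_mx 0 q); rewrite mulmxDl -def_v -scalemxAl -rowE subrK.
Qed.

(** The matrix is triangular: column next_facet q meets row q on a nonzero entry
and otherwise only rows q' > q, those whose facet has next_facet q as parent.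
The coefficients of v therefore vanish from the last one downwards. *)
Lemma leaf_syz_inj (v : 'rV[R]_n) : v *m leaf_syz = 0 -> v = 0.
Proof.
move=> v0; apply/rowP=> q; rewrite mxE; move: {-1}(n - q)%N (leqnn (n - q)) => m.
elim: m q => [|m IHm] q; first by rewrite leqn0 subn_eq0 leqNgt ltn_ord.
move=> m_q; have := congr1 (fun M : 'rV_n.+1 => M ord0 (next_facet q)) v0.
rewrite !mxE (bigD1 q) //= big1 ?addr0 => [|q' q'_q].
  rewrite mxE eqxx eq_sym parent_neq subr0 mul1r => /eqP.
  by rewrite mulf_eq0 (negPf (xprod_neq0 _ _)) orbF => /eqP.
case: (ltngtP q q') => [q_lt | q'_lt | q_eq].
- rewrite IHm ?mul0r // -ltnS; apply: leq_trans m_q.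
  by rewrite ltn_sub2l.
- rewrite mxE (inj_eq lift_inj) eq_sym (negPf q'_q) sub0r.
  have /negPf -> : next_facet q != parent q'.
    rewrite -val_eqE /= /bump leq0n add1n neq_ltn ltnS.
    by rewrite (leq_trans (parent_leq q')) ?orbT // ltnW.
  by rewrite oppr0 mul0r mulr0.
- by case/eqP: q'_q; apply: val_inj.
Qed.

Definition leaf_rank i : nat := match i with 0 => 1 | 1 => n.+1 | 2 => n | _ => 0 end.

Definition leaf_resolution : free_sequence K T :=
  @FreeSequence K T leaf_rank
    (fun i => match i return 'I_(leaf_rank i) -> multidegree T with
      | 1 => fun k => sqfree (~: S k)
      | 2 => fun q => sqfree (~: sep q)
      | _ => fun=> 0 end)
    (fun i => match i return 'M[R]_(leaf_rank i.+1, leaf_rank i) with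
      | 0 => leaf_gens
      | 1 => leaf_syz
      | _ => 0 end)
    1%:M.

Lemma leaf_resolution_multigraded : multigraded leaf_resolution.
Proof.
split=> [j | [|[|i]] j k].
- by rewrite /= mxE ord1 eqxx; apply: homogeneous1.
- by rewrite /= mxE subr0; apply: xprod_homogeneous.
- rewrite /= mxE; have [k_j|k_j] := boolP ((k == next_facet j) || (k == parent j)); last first.
    move: k_j; rewrite negb_or => /andP[/negPf -> /negPf ->].
    by rewrite subrr mul0r; apply: homogeneous0.
  have -> : sqfree (~: sep j) - sqfree (~: S k) = sqfree (S k :\: sep j).
    apply/ffunP=> x; rewrite !ffunE !inE.
    by case/orP: k_j => /eqP ->; do 2!case: (x \in S _).
  rewrite -[sqfree _]add0r; apply: homogeneousM; last exact: xprod_homogeneous.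
  (* The sign is a constant polynomial, homogeneous of degree 0. *)
  move=> m; rewrite -mpolyC_nat -[X in _ - X]mpolyC_nat -mpolyCB msuppC.
  by case: ifP => // _; rewrite inE => /eqP -> x; rewrite mnm0E ffunE.
- by rewrite /= mxE; apply: homogeneous0.
Qed.

(** A generator is constant only if its facet is everything, which would contain
all other facets; a syzygy has a constant entry only if one of two distinct
facets contains the other. *)
Lemma leaf_resolution_minimal : minimal leaf_resolution.
Proof.
move=> [|[|i]] j k; rewrite /= ?mcoeff0 //= mxE ?mcoeff0 //.
  apply: xprod_coef0; apply/negP=> /eqP Sj.
  have all_eq i : i = j by apply: S_incomparable; rewrite -[S j]setCK Sj setC0 subsetT.
  have := congr1 val (etrans (all_eq ord0) (esym (all_eq ord_max))).
  by move=> /= n0; move: n_gt0; rewrite -n0.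
have [k_j|k_j] := boolP ((k == next_facet j) || (k == parent j)); last first.
  move: k_j; rewrite negb_or => /andP[/negPf -> /negPf ->].
  by rewrite subrr mul0r mcoeff0.
rewrite (mcoeff0_is_multiplicative _ _).1 xprod_coef0 ?mulr0 // setD_eq0.
apply/negP; rewrite subsetI => /andP[S1 S2].
have := parent_neq j; case/orP: k_j S1 S2 => /eqP -> S1 S2.
  by rewrite (S_incomparable S1) eqxx.
by rewrite -(S_incomparable S2) eqxx.
Qed.

Lemma leaf_resolution_resolves (Sigma : {set {set T}}) :
  (forall A, (A \notin Sigma) = [exists k, ~: S k \subset A]) ->
  resolves (SR_ideal Sigma) leaf_resolution.
Proof.
move=> SigmaE; have [I0 ID _ _] := @SR_homogeneous_ideal K T Sigma.
split=> [p | u | [|[|i]] u].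
- by exists p%:M; rewrite /= mulmx1 mxE eqxx subrr.
- rewrite /= mulmx1; split=> [[c def_u] | [v ->]]; last first.
    rewrite mxE; apply: big_ind => // k _; rewrite mxE; apply: SR_ideal_gen.
    by rewrite SigmaE; apply/existsP; exists k.
  suff [v def_v] : exists v, (u ord0 ord0)%:M = v *m leaf_gens.
    by exists v; rewrite -def_v; apply/matrixP=> i j; rewrite !ord1 mxE eqxx mulr1n.
  rewrite def_u; apply: (big_ind (fun p : R => exists v, p%:M = v *m leaf_gens)).
  + by exists 0; rewrite mul0mx raddf0.
  + by move=> p q [v Dp] [w Dq]; exists (v + w); rewrite mulmxDl raddfD /= Dp Dq.
  move=> A; rewrite SigmaE => /existsP[k SkA].
  exists ((c A * xprod K (A :&: S k)) *: delta_mx 0 k); rewrite -scalemxAl -rowE.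
  apply/matrixP=> i j; rewrite !ord1 !mxE mulr1n -mulrA; congr (_ * _).
  rewrite -xprodU; last first.
    by rewrite -setI_eq0; apply/eqP/setP=> x; rewrite !inE; case: (x \in S k); rewrite ?andbF.
  congr (xprod K _); apply/setP=> x; rewrite !inE.
  by have := subsetP SkA x; rewrite inE; case: (x \in S k); rewrite ?andbF ?andbT ?orbF //= => ->.
- rewrite /=; split=> [|[v ->]]; first exact: leaf_syz_exact.
  by rewrite -mulmxA leaf_syz_gens mulmx0.
- rewrite /=; split=> [/leaf_syz_inj -> | [v ->]]; last by rewrite mulmx0 mul0mx.
  by exists 0; rewrite mul0mx.
- rewrite /= mulmx0; split=> // _; exists 0.
  by apply/rowP; case.
Qed.

End LeafResolution.
(** * Betti numbers of the dual complex *)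

Section DualBetti.
Variables (K : fieldType) (T : finType).
Implicit Types (Sigma : {set {set T}}) (S : seq {set T}).

Definition simplicial Sigma := forall A B : {set T}, B \subset A -> A \in Sigma -> B \in Sigma.

Lemma clique_complex_simplicial (e : rel T) : simplicial (clique_complex e).
Proof.
move=> A B BA; rewrite !inE => /forall_inP clA; apply/forall_inP=> x x_B.
apply/forall_inP=> y y_B; have /forall_inP := clA x (subsetP BA x x_B).
by apply; apply: subsetP BA y y_B.
Qed.

Lemma facet_exists Sigma A : A \in Sigma -> exists2 B, B \in facets Sigma & A \subset B.
Proof.
by case/(@maxset_exists _ (fun B => B \in Sigma))=> B maxB AB; exists B; rewrite ?inE.
Qed.

Lemma facet_mem Sigma A : A \in facets Sigma -> A \in Sigma.
Proof. by rewrite inE => /maxsetp. Qed.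

Lemma facets_inj Sigma Sigma' : simplicial Sigma -> simplicial Sigma' ->
  facets Sigma =i facets Sigma' -> Sigma = Sigma'.
Proof.
move=> sS sS' eqF; apply/setP=> A; apply/idP/idP=> /facet_exists[B].
  by rewrite eqF => /facet_mem B_S AB; apply: sS' B_S.
by rewrite -eqF => /facet_mem B_S AB; apply: sS B_S.
Qed.

(** The union in the definition of a separator collapses to its intersection
with the parent facet, which is where the leaf property says that all earlier
intersections lie. *)
Lemma separator_parent S q p :
  (p <= q)%N ->
  (forall i, (i < q.+1)%N ->
    nth set0 S q.+1 :&: nth set0 S i \subset nth set0 S q.+1 :&: nth set0 S p) ->
  separator S q = nth set0 S p :&: nth set0 S q.+1.
Proof.
move=> p_q leaf; apply/eqP; rewrite eqEsubset; apply/andP; split; last first.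
  by apply: setSI; apply: (bigcup_sup (Ordinal (p_q : (p < q.+1)%N))).
apply/subsetP=> x /setIP[/bigcupP[i _ x_i] x_q].
by rewrite setIC; apply: (subsetP (leaf i (ltn_ord i))); rewrite inE x_q.
Qed.

Theorem betti_alexander_dual Sigma S i a :
  simplicial Sigma -> leaf_order Sigma S -> (2 <= size S)%N ->
  betti K (alexander_dual Sigma) i.+1 a =
    match i with
    | 0 => #|[set m : 'I_(size S) | sqfree (~: nth set0 S m) == a]|
    | 1 => #|[set q : 'I_(size S).-1 | sqfree (~: separator S q) == a]|
    | _ => 0
    end.
Proof.
move=> sSigma [uS memS leafS] S_gt1.
have [n size_S] : exists n, size S = n.+1 by exists (size S).-1; rewrite prednK // ltnW.
rewrite size_S /=; pose s (k : 'I_n.+1) := nth set0 S k.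
have s_facet k : s k \in facets Sigma by rewrite -memS mem_nth // size_S.
have par (q : 'I_n) : exists p : 'I_n.+1, (p <= q)%N /\
    forall j, (j < q.+1)%N ->
      nth set0 S q.+1 :&: nth set0 S j \subset nth set0 S q.+1 :&: nth set0 S p.
  have [|p p_q leaf_p] := leafS q.+1; first by rewrite ltn0Sn size_S /= ltnS ltn_ord.
  have p_n : (p < n.+1)%N by apply: leq_trans p_q _; apply: ltnW; rewrite ltnS ltn_ord.
  by exists (Ordinal p_n).
have [parent /all_and2[parent_leq leaf]] := fin_all_exists par.
have next_val (q : 'I_n) : next_facet q = q.+1 :> nat by rewrite /= /bump leq0n.
have leaf_s (q : 'I_n) (j : 'I_n.+1) : (j <= q)%N ->
    s (next_facet q) :&: s j \subset s (parent q).
  by move=> j_q; rewrite {1}/s next_val; apply: subset_trans (leaf q j j_q) (subsetIr _ _).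
have s_inc j k : s j \subset s k -> j = k.
  have := s_facet j; rewrite inE => /maxsetP[_ maxj] jk.
  have /eqP := maxj _ (facet_mem (s_facet k)) jk.
  by rewrite nth_uniq ?size_S // => /eqP kj; apply: val_inj.
have n_gt0 : (0 < n)%N by rewrite -ltnS -size_S.
have sepE q : sep s parent q = separator S q.
  by rewrite (separator_parent (parent_leq q) (leaf q)) /sep {2}/s next_val.
have resF : minimal_free_resolution (@SR_ideal K T (alexander_dual Sigma))
    (leaf_resolution K s parent).
  split; first exact: leaf_resolution_multigraded.
    apply: leaf_resolution_resolves => // A; rewrite inE negbK.
    apply/idP/existsP=> [/facet_exists[B] | [k kA]].
      rewrite -memS => B_S AB; have B_n : (index B S < n.+1)%N by rewrite -size_S index_mem.
      by exists (Ordinal B_n); rewrite /s nth_index // -setCS setCK.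
    by apply: sSigma (facet_mem (s_facet k)); rewrite -setCS setCK.
  exact: leaf_resolution_minimal.
rewrite (betti_of_resolution _ _ resF); case: i => [|[|i]] //=.
  by apply: eq_card => q; rewrite !inE sepE.
by apply: eq_card0; case.
Qed.

End DualBetti.

Section Multiplicities.
Variables (T : finType).
Implicit Types (S : seq {set T}).

Lemma card_ord_count (r : seq {set T}) A :
  #|[set m : 'I_(size r) | ~: nth set0 r m == A]| = count_mem (~: A) r.
Proof.
rewrite -sum1_card -sum1_count (big_nth set0) big_mkord.
by apply: eq_bigl => m; rewrite inE /= -(inj_eq (@setC_inj T)) setCK.
Qed.

Lemma card_separator_count S A :
  #|[set q : 'I_(size S).-1 | ~: separator S q == A]| = count_mem (~: A) (separators S).
Proof.
rewrite -sum1_card -sum1_count big_map -[X in iota 0 X]subn0 big_mkord.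
by apply: eq_bigl => q; rewrite inE /= -(inj_eq (@setC_inj T)) setCK.
Qed.

End Multiplicities.

Theorem corollary7 (K : fieldType) (T : finType) (e : rel T)
    (S : seq {set T}) :
  simple_graph e -> chordal e ->
  leaf_order (clique_complex e) S -> (2 <= size S)%N ->
  let beta := betti K (alexander_dual (clique_complex e)) in
  (forall A : {set T},
     beta 1%N (sqfree A) = #|[set m : 'I_(size S) | ~: nth set0 S m == A]|) /\
  (forall A : {set T},
     beta 2%N (sqfree A) =
       #|[set q : 'I_(size S).-1 | ~: separator S q == A]|) /\
  (forall (i : nat) (a : multidegree T), (3 <= i)%N -> beta i a = 0%N) /\
  (forall (i : nat) (a : multidegree T), (1 <= i)%N ->
     (forall A : {set T}, a <> sqfree A) -> beta i a = 0%N) /\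
  (forall (e' : rel T) (S' : seq {set T}),
     simple_graph e' -> chordal e' ->
     leaf_order (clique_complex e') S' -> (2 <= size S')%N ->
     let beta' := betti K (alexander_dual (clique_complex e')) in
     ((forall A : {set T}, beta 1%N (sqfree A) = beta' 1%N (sqfree A)) ->
        clique_complex e = clique_complex e') /\
     ((forall A : {set T}, beta 2%N (sqfree A) = beta' 2%N (sqfree A)) ->
        perm_eq (separators S) (separators S'))).
Proof.
move=> _ _ leafS S_gt1 beta.
have betaE := betti_alexander_dual K _ _ (@clique_complex_simplicial T e) leafS S_gt1.
have degree1 (A : {set T}) :
    beta 1%N (sqfree A) = #|[set m : 'I_(size S) | ~: nth set0 S m == A]|.
  by rewrite /beta betaE; apply: eq_card => m; rewrite !inE (inj_eq (@sqfree_inj T)).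
have degree2 (A : {set T}) :
    beta 2%N (sqfree A) = #|[set q : 'I_(size S).-1 | ~: separator S q == A]|.
  by rewrite /beta betaE; apply: eq_card => m; rewrite !inE (inj_eq (@sqfree_inj T)).
do 4?split=> //.
- by case=> [|[|[|i]]] a // _; rewrite /beta betaE.
- case=> [|i] a // _ aN; rewrite /beta betaE; case: i => [|[|i]] //.
    by apply: eq_card0 => m; rewrite !inE; apply/eqP=> /esym; apply: aN.
  by apply: eq_card0 => m; rewrite !inE; apply/eqP=> /esym; apply: aN.
move=> e' S' _ _ leafS' S'_gt1 beta'.
have betaE' := betti_alexander_dual K _ _ (@clique_complex_simplicial T e') leafS' S'_gt1.
split=> [eq1 | eq2].
  apply: facets_inj; [exact: clique_complex_simplicial.. | move=> B].
  have [[_ memS _] [_ memS' _]] := (leafS, leafS').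
  rewrite -memS -memS' -!has_pred1 !has_count -[B]setCK -!card_ord_count -degree1 eq1.
  rewrite /beta' betaE'; congr (0 < _)%N.
  by apply: eq_card => m; rewrite !inE (inj_eq (@sqfree_inj T)).
apply/allP=> B _; apply/eqP; rewrite -[B]setCK -!card_separator_count -degree2 eq2.
rewrite /beta' betaE'.
by apply: eq_card => m; rewrite !inE (inj_eq (@sqfree_inj T)).
Qed.
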